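(* Let $K,L\in\mathcal S^n$, $0\le i<n$ ($i$ an integer) and $\phi\in\mathcal C$. Then $$\widetilde W_{\phi,i}(K,L)\ \ge\ \widetilde W_i(K)\,\phi\left(\left(\frac{\widetilde W_i(L)}{\widetilde W_i(K)}\right)^{1/(n-i)}\right).$$ If $\phi$ is strictly convex, equality holds if and only if $K$ and $L$ are dilates.
   Context: $\mathcal S^n$ is the set of star bodies (about the origin) in $\mathbb R^n$: compact sets $K$, star-shaped with respect to the origin, whose radial function $\rho(K,u)=\max\{c\ge 0: cu\in K\}$, $u\in S^{n-1}$, is positive and continuous. Two star bodies $K,L$ are dilates if $\rho(K,u)/\rho(L,u)$ is independent of $u\in S^{n-1}$. $S$ denotes spherical Lebesgue measure on $S^{n-1}$. $\mathcal C$ is the class of convex, decreasing functions $\phi:(0,\infty)\to(0,\infty)$ with $\lim_{t\to 0^+}\phi(t)=\infty$ (convention $\phi(0)=\infty$) and $\lim_{t\to\infty}\phi(t)=0$. The dual quermassintegral of $K$ is $\widetilde W_i(K)=\frac1n\int_{S^{n-1}}\rho(K,u)^{n-i}\,dS(u)$, and the Orlicz dual mixed quermassintegral of $K$ and $L$ is $$\widetilde W_{\phi,i}(K,L)=\frac1n\int_{S^{n-1}}\phi\left(\frac{\rho(L,u)}{\rho(K,u)}\right)\rho(K,u)^{n-i}\,dS(u).$$ *)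

(* Defs.v *)
From HB Require Import structures.
From mathcomp Require Import all_boot all_order all_algebra.
From mathcomp Require Import interval_inference.
From mathcomp Require Import all_classical all_reals all_analysis.
From mathcomp Require Import measurable_realfun.

Set Implicit Arguments.
Unset Strict Implicit.
Unset Printing Implicit Defensive.
Import Order.TTheory GRing.Theory Num.Theory.
Import numFieldNormedType.Exports.

Local Open Scope classical_set_scope.
Local Open Scope ring_scope.

(* R^n is 'rV[R]_n.  The norm of the library on 'rV[R]_n is the sup norm: it
   gives the usual topology, but the unit sphere needs the Euclidean norm. *)

Definition enorm (R : rcfType) (n : nat) (x : 'rV[R]_n) : R :=
  Num.sqrt (\sum_(j < n) x 0 j ^+ 2).

Definition sphere (R : rcfType) (n : nat) : set 'rV[R]_n :=
  [set u | enorm u = 1].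
Arguments sphere {R n}.

(* The product sigma-algebra on R^n, i.e. its Borel sets. *)

Definition measure_rV_display : measure_display.
Proof. exact: default_measure_display. Qed.

Section measurable_rV.
Context (R : realType) (n : nat).

Let coords : 'I_n -> 'rV[R]_n -> R := fun j x => x 0 j.

Let rV_set0 : g_sigma_preimage coords set0.
Proof. exact: sigma_algebra0. Qed.

Let rV_setC A : g_sigma_preimage coords A -> g_sigma_preimage coords (~` A).
Proof. exact: sigma_algebraC. Qed.

Let rV_bigcup (F : _^nat) : (forall i, g_sigma_preimage coords (F i)) ->
  g_sigma_preimage coords (\bigcup_i (F i)).
Proof. exact: sigma_algebra_bigcup. Qed.

HB.instance Definition _ := @isMeasurable.Build measure_rV_display
  'rV[R]_n (g_sigma_preimage coords) rV_set0 rV_setC rV_bigcup.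

Lemma measurable_coord_rV (j : 'I_n) :
  measurable_fun [set: 'rV[R]_n] (fun x : 'rV[R]_n => x 0 j).
Proof.
move=> _ Y mY; rewrite setTI; apply: sub_sigma_algebra => /=.
rewrite -bigcup_seq/=; exists j => /=; first by rewrite mem_index_enum.
by exists Y => //; rewrite setTI.
Qed.

Lemma measurable_fun_rV d (T : measurableType d) (f : T -> 'rV[R]_n) :
  (forall j, measurable_fun [set: T] (fun t => f t 0 j)) ->
  measurable_fun [set: T] f.
Proof.
move=> mf.
have H : g_sigma_preimage coords `<=` [set A | measurable (f @^-1` A)].
  apply: smallest_sub.
    split => /=.
    - by rewrite preimage_set0.
    - by move=> A mA; rewrite setTD -preimage_setC; exact: measurableC.
    - move=> F mF; rewrite preimage_bigcup; exact: bigcupT_measurable.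
  rewrite -bigcup_seq => A [j _ [B mB <-]].
  rewrite setTI/= -comp_preimage -[X in measurable X]setTI; exact: (mf j).
by move=> _ A mA; rewrite setTI; exact: H.
Qed.

End measurable_rV.

(* Lebesgue measure on R^n: the unit mass on R^0 = {0}, and on R^(n+1) the
   product of the Lebesgue measures of R and R^n, transported along the
   identification cons_rV of R x R^n with R^(n+1). *)

Definition cons_rV (R : realType) (n : nat) (p : R * 'rV[R]_n) : 'rV[R]_n.+1 :=
  row_mx p.1%:M p.2.

Section lebesgue_rV.
Context (R : realType).

Lemma measurable_cons_rV n : measurable_fun setT (@cons_rV R n).
Proof.
apply: measurable_fun_rV => j.
have [k ->|k ->] := @split_ordP 1 n j.
- rewrite (_ : (fun _ => _) = fst); first exact: measurable_fst.
  apply/funext => p; rewrite /cons_rV.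
  by rewrite (@row_mxEl _ _ 1 n) ord1 mxE eqxx mulr1n.
- rewrite (_ : (fun _ => _) = (fun p : R * 'rV[R]_n => p.2 0 k)).
    exact: (measurableT_comp (measurable_coord_rV k) measurable_snd).
  by apply/funext => p; rewrite /cons_rV (@row_mxEr _ _ 1 n).
Qed.

Definition uncons_rV n (x : 'rV[R]_n.+1) : R * 'rV[R]_n :=
  (x 0 0, \row_j x 0 (rshift 1 j)).

Lemma measurable_uncons_rV n : measurable_fun setT (@uncons_rV n).
Proof.
apply/measurable_fun_pairP; split; first exact: measurable_coord_rV.
apply: measurable_fun_rV => j.
rewrite (_ : (fun _ => _) = (fun x : 'rV[R]_n.+1 => x 0 (rshift 1 j))).
  exact: measurable_coord_rV.
by apply/funext => x; rewrite /= mxE.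
Qed.

Lemma cons_rVK n : cancel (@cons_rV R n) (@uncons_rV n).
Proof.
case=> a x; rewrite /uncons_rV /cons_rV; congr pair.
  rewrite (_ : 0 = @lshift 1 n 0); last exact/val_inj.
  by rewrite (@row_mxEl _ _ 1 n) mxE eqxx mulr1n.
by apply/rowP => j; rewrite mxE (@row_mxEr _ _ 1 n).
Qed.

Section step.
Context (n : nat).
Variable mu : {sigma_finite_measure set 'rV[R]_n -> \bar R}.

Definition lebesgue_rVS : set 'rV[R]_n.+1 -> \bar R :=
  pushforward (lebesgue_measure \x mu)%E (@cons_rV R n).

Let mcons : measurable_fun setT (@cons_rV R n) := @measurable_cons_rV n.

Let lebesgue_rVS0 : lebesgue_rVS set0 = 0%E.
Proof. exact: measure0. Qed.

Let lebesgue_rVS_ge0 A : (0 <= lebesgue_rVS A)%E.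
Proof. exact: measure_ge0. Qed.

Let lebesgue_rVS_sigma_additive : semi_sigma_additive lebesgue_rVS.
Proof. exact: measure_semi_sigma_additive. Qed.

HB.instance Definition _ := isMeasure.Build _ _ _ lebesgue_rVS
  lebesgue_rVS0 lebesgue_rVS_ge0 lebesgue_rVS_sigma_additive.

Let lebesgue_rVS_sigma_finite : sigma_finite setT lebesgue_rVS.
Proof.
have /sigma_finiteP[F [FT ndF Foo]] := sigma_finiteT (@lebesgue_measure R).
have /sigma_finiteP[G [GT ndG Goo]] := sigma_finiteT mu.
exists (fun k => @uncons_rV n @^-1` (F k `*` G k)).
  apply/seteqP; split => // x _.
  have [i _ Fi] : (\bigcup_k F k) (x 0 0) by rewrite -FT.
  have [j _ Gj] : (\bigcup_k G k) (uncons_rV x).2 by rewrite -GT.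
  exists (maxn i j) => //; split => /=.
    by move: Fi; exact/subsetPset/ndF/leq_maxl.
  by move: Gj; exact/subsetPset/ndG/leq_maxr.
move=> k; have [mF Fk] := Foo k; have [mG Gk] := Goo k; split.
  rewrite -[X in measurable X]setTI; apply: measurable_uncons_rV => //.
  exact: measurableX.
rewrite /lebesgue_rVS /pushforward -comp_preimage.
rewrite (_ : _ \o _ = idfun); last by apply/funext => p; exact: cons_rVK.
by rewrite preimage_id product_measure1E// lte_mul_pinfty// ge0_fin_numE.
Qed.

HB.instance Definition _ :=
  Measure_isSigmaFinite.Build _ _ _ lebesgue_rVS lebesgue_rVS_sigma_finite.

End step.

Fixpoint lebesgue_rV (n : nat) :
    {sigma_finite_measure set 'rV[R]_n -> \bar R} :=
  if n is m.+1 then lebesgue_rVS (lebesgue_rV m) else dirac (0 : 'rV[R]_0).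

End lebesgue_rV.

(* Spherical Lebesgue measure, as a measure on R^n carried by the sphere:
   S(A) is n times the volume of the cone over A in the unit ball,
     S(A) = n * lebesgue_rV {x | enorm x <= 1 and x / enorm x \in A}
   for A included in the sphere. At x = 0, x / enorm x is 0 since 0^-1 = 0,
   and 0 is not on the sphere. *)

Definition direction (R : realType) (n : nat) (x : 'rV[R]_n) : 'rV[R]_n :=
  (enorm x)^-1 *: x.

Definition unit_ball (R : rcfType) (n : nat) : set 'rV[R]_n :=
  [set x | enorm x <= 1].

Section spherical_measure.
Context (R : realType) (n : nat).

Lemma measurable_enorm : measurable_fun setT (@enorm R n).
Proof.
apply: (measurableT_comp (f := @Num.sqrt R)).
  apply: continuous_measurable_fun; exact: sqrt_continuous.
apply: measurable_sum => j; apply: measurable_funX.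
exact: measurable_coord_rV.
Qed.

Lemma measurable_direction : measurable_fun setT (@direction R n).
Proof.
apply: measurable_fun_rV => j.
rewrite (_ : (fun _ => _) = (fun x : 'rV[R]_n => enorm x `^ (-1) * x 0 j)).
  apply: measurable_funM; last exact: measurable_coord_rV.
  exact: (measurableT_comp (measurable_powR (-1)) measurable_enorm).
by apply/funext => x; rewrite mxE powR_inv1// sqrtr_ge0.
Qed.

Lemma measurable_unit_ball : measurable (@unit_ball R n).
Proof.
rewrite (_ : @unit_ball R n = setT `&` @enorm R n @^-1` `]-oo, 1]).
  exact: measurable_enorm.
by rewrite setTI; apply/seteqP; split => x /=; rewrite in_itv.
Qed.

Definition cone_volume : set 'rV[R]_n -> \bar R :=
  pushforward (mrestr (lebesgue_rV R n) measurable_unit_ball) (@direction R n).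

Let mdirection : measurable_fun setT (@direction R n) := measurable_direction.

Let cone_volume0 : cone_volume set0 = 0%E.
Proof. exact: measure0. Qed.

Let cone_volume_ge0 A : (0 <= cone_volume A)%E.
Proof. exact: measure_ge0. Qed.

Let cone_volume_sigma_additive : semi_sigma_additive cone_volume.
Proof. exact: measure_semi_sigma_additive. Qed.

HB.instance Definition _ := isMeasure.Build _ _ _ cone_volume
  cone_volume0 cone_volume_ge0 cone_volume_sigma_additive.

Definition spherical_measure : set 'rV[R]_n -> \bar R :=
  mscale n%:R%:nng cone_volume.

HB.instance Definition _ := Measure.on spherical_measure.

End spherical_measure.

(* For K compact, star-shaped and nonempty, and u != 0, the supremum is a
   maximum. *)
Definition radial (R : realType) (n : nat) (K : set 'rV[R]_n)
    (u : 'rV[R]_n) : R :=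
  sup [set c | 0 <= c /\ K (c *: u)].

Definition star_body (R : realType) (n : nat) (K : set 'rV[R]_n) : Prop :=
  [/\ compact K,
      (forall x t, K x -> 0 <= t <= 1 -> K (t *: x)),
      (forall u, sphere u -> 0 < radial K u) &
      {within sphere, continuous (radial K)}].

Definition dilates (R : realType) (n : nat) (K L : set 'rV[R]_n) : Prop :=
  exists c : R, forall u, sphere u -> radial K u / radial L u = c.

(* A function on (0, +oo) is represented by a total function on R whose values
   outside (0, +oo) are irrelevant. *)
Definition class_C (R : realType) (phi : R -> R) : Prop :=
  [/\ (forall t, 0 < t -> 0 < phi t),
      convex_function (`]0, +oo[ : set R) phi,
      (forall s t, 0 < s -> s <= t -> phi t <= phi s),
      phi t @[t --> 0^'+] --> +oo &
      phi t @[t --> +oo] --> 0].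

Definition strictly_convex (R : realType) (phi : R -> R) : Prop :=
  forall s t l : R, 0 < s -> 0 < t -> s != t -> 0 < l < 1 ->
    phi (l * s + (1 - l) * t) < l * phi s + (1 - l) * phi t.

Definition dual_quermass (R : realType) (n i : nat) (K : set 'rV[R]_n) : R :=
  n%:R^-1 *
  \int[@spherical_measure R n]_(u in sphere) (radial K u ^+ (n - i)).

Definition orlicz_dual_mixed_quermass (R : realType) (n : nat) (phi : R -> R)
    (i : nat) (K L : set 'rV[R]_n) : R :=
  n%:R^-1 *
  \int[@spherical_measure R n]_(u in sphere)
    (phi (radial L u / radial K u) * radial K u ^+ (n - i)).

(* Main.v *)
(* Put p = n - i and m = (W_i(L) / W_i(K))^(1/p). A supporting line of phi at
   m has slope a <= 0, and Bernoulli's inequality bounds a (t - m) below by a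
   multiple of t^p - m^p; hence phi t >= phi m + c (t^p - m^p) for all t > 0,
   with strict inequality for t != m when phi is strictly convex. Take t =
   rho_L / rho_K, multiply by rho_K^p and integrate over the sphere: the
   choice of m makes the c-term vanish, which is the inequality. In the
   equality case a direction with rho_L / rho_K != m would give strict
   inequality on a relatively open subset of the sphere; such a set has
   positive spherical measure because the cone over it contains a box. *)

Require Import Defs.
From mathcomp Require Import all_boot all_order all_algebra.
From mathcomp Require Import ring lra.
From mathcomp Require Import all_classical all_reals all_analysis.
From mathcomp Require Import measurable_realfun.
Set Implicit Arguments.
Unset Strict Implicit.
Unset Printing Implicit Defensive.
Import Order.TTheory GRing.Theory Num.Theory.
Import numFieldNormedType.Exports.
Local Open Scope classical_set_scope.
Local Open Scope ring_scope.

(** * Convex functions: supporting lines, and their analogue in the variable t^p *)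

Lemma convex_function_le (R : realType) (phi : R -> R) (s t l : R) :
  convex_function (`]0, +oo[ : set R) phi -> 0 < s -> 0 < t -> 0 <= l <= 1 ->
  phi (l * s + (1 - l) * t) <= l * phi s + (1 - l) * phi t.
Proof.
move=> cphi s0 t0 /andP[l0 l1].
have := cphi (Itv01 l0 l1) s t.
by rewrite !inE /= !in_itv /= !andbT => /(_ s0 t0).
Qed.

Lemma chord_slope_le (R : realType) (phi : R -> R) (s m t : R) :
  convex_function (`]0, +oo[ : set R) phi -> 0 < s -> s < m -> m < t ->
  (phi m - phi s) / (m - s) <= (phi t - phi m) / (t - m).
Proof.
move=> cphi s0 sm mt.
have ms0 : 0 < m - s by rewrite subr_gt0.
have tm0 : 0 < t - m by rewrite subr_gt0.
have ts0 : 0 < t - s by lra.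
have t0 : 0 < t by lra.
(* This is the weight on [s] for which the convex combination of [s] and [t] is [m]. *)
have l01 : 0 <= (t - m) / (t - s) <= 1.
  by apply/andP; split; [rewrite divr_ge0// ltW|rewrite ler_pdivrMr//; lra].
have := convex_function_le cphi s0 t0 l01.
have -> : (t - m) / (t - s) * s + (1 - (t - m) / (t - s)) * t = m.
  by field; lra.
move=> H; rewrite ler_pdivrMr// mulrAC ler_pdivlMr//.
have {H} : phi m * (t - s) <= (t - m) * phi s + (m - s) * phi t.
  rewrite -ler_pdivlMr//; apply: (le_trans H).
  by rewrite le_eqVlt; apply/orP; left; apply/eqP; field; lra.
by move=> H; nra.
Qed.

(** The slope is the supremum of the chord slopes to the left of [m]. By [chord_slope_le] every
    chord slope to the right bounds them above, which settles [t > m]. The sign comes from the chord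
    to [m + 1], whose slope is nonpositive because [phi] decreases. *)
Lemma supporting_slope (R : realType) (phi : R -> R) (m : R) :
  convex_function (`]0, +oo[ : set R) phi ->
  (forall s t, 0 < s -> s <= t -> phi t <= phi s) -> 0 < m ->
  exists2 a, a <= 0 & forall t, 0 < t -> phi m + a * (t - m) <= phi t.
Proof.
move=> cphi dphi m0.
pose E := [set (phi m - phi s) / (m - s) | s in [set s | 0 < s < m]].
have E0 : E !=set0.
  by exists ((phi m - phi (m / 2)) / (m - m / 2)), (m / 2) => //=; lra.
have ubE t : m < t -> ubound E ((phi t - phi m) / (t - m)).
  by move=> mt _ [s /andP[s0 sm] <-]; exact: chord_slope_le.
have supE t : m < t -> sup E <= (phi t - phi m) / (t - m).
  by move=> mt; apply: ge_sup => //; exact: ubE.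
exists (sup E) => [|t t0].
  apply: (le_trans (supE (m + 1) _)); first by rewrite ltrDl.
  rewrite addrAC subrr add0r divr1 subr_le0; apply: dphi => //.
  by rewrite lerDl.
have [tm|mt|->] := ltgtP t m; last by rewrite subrr mulr0 addr0.
- have : (phi m - phi t) / (m - t) <= sup E.
    apply: ub_le_sup; last by exists t => //=; rewrite t0.
    (* The chord to [m + 1] only witnesses that [E] is bounded above. *)
    by exists ((phi (m + 1) - phi m) / (m + 1 - m)); apply: ubE; rewrite ltrDl.
  by rewrite ler_pdivrMr ?subr_gt0//; lra.
- have := supE t mt; rewrite ler_pdivlMr ?subr_gt0//; lra.
Qed.

(** Multiplying the induction hypothesis by [x] leaves a surplus of exactly p (x - 1)^2 over the
    next bound. *)
Lemma bernoulli_ineq (R : realType) (x : R) (p : nat) :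
  0 <= x -> 1 + p%:R * (x - 1) <= x ^+ p.
Proof.
move=> x0; elim: p => [|p IH]; first by rewrite expr0; lra.
have p0 : 0 <= p%:R :> R by [].
rewrite exprS -natr1; have := ler_wpM2l x0 IH.
by have := mulr_ge0 p0 (sqr_ge0 (x - 1)); nra.
Qed.

Lemma power_support (R : realType) (phi : R -> R) (m : R) (p : nat) :
  convex_function (`]0, +oo[ : set R) phi ->
  (forall s t, 0 < s -> s <= t -> phi t <= phi s) -> 0 < m -> (0 < p)%N ->
  exists c, (forall t, 0 < t -> phi m + c * (t ^+ p - m ^+ p) <= phi t) /\
    (strictly_convex phi ->
     forall t, 0 < t -> t != m -> phi m + c * (t ^+ p - m ^+ p) < phi t).
Proof.
move=> cphi dphi m0 p0; have [a a0 aphi] := supporting_slope cphi dphi m0.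
have p0' : 0 < p%:R :> R by rewrite ltr0n.
have mp0 : 0 < m ^+ p by rewrite exprn_gt0.
(* With this [c] the function c t^p has derivative [a] at [m]. Bernoulli is applied to [t / m] and
   multiplied by the nonpositive [a * m / p%:R], which reverses it. *)
exists (a * m / p%:R / m ^+ p).
have cle t : 0 < t ->
    a * m / p%:R / m ^+ p * (t ^+ p - m ^+ p) <= a * (t - m).
  move=> t0; have := bernoulli_ineq p (ltW (divr_gt0 t0 m0)).
  rewrite expr_div_n => b.
  have -> : a * m / p%:R / m ^+ p * (t ^+ p - m ^+ p) =
            a * m / p%:R * (t ^+ p / m ^+ p - 1).
    by field; rewrite !gt_eqF.
  have -> : a * (t - m) = a * m / p%:R * (p%:R * (t / m - 1)).
    by field; rewrite !gt_eqF.
  apply: ler_wnM2l; last lra.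
  by rewrite mulr_le0_ge0 ?invr_ge0 ?(ltW p0')// mulr_le0_ge0// ltW.
split=> [t t0|sphi t t0 tm].
  by apply: le_trans (aphi t t0); rewrite lerD2l cle.
apply: (@le_lt_trans _ _ (phi m + a * (t - m))); first by rewrite lerD2l cle.
(* At the midpoint of [t] and [m], strict convexity bounds [phi] from above and the supporting line
   bounds it from below. Together they make the supporting line strict at [t]. *)
have h01 : 0 < (2^-1 : R) < 1 by lra.
have := sphi t m 2^-1 t0 m0 tm h01.
have mid0 : 0 < 2^-1 * t + (1 - 2^-1) * m by lra.
have := aphi _ mid0; lra.
Qed.

(** * Boxes, open sets and Lebesgue measure in R^n *)

Definition open_box (R : realType) (n : nat) (a b : 'rV[R]_n) : set 'rV[R]_n :=
  [set x | forall j, a 0 j < x 0 j < b 0 j].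

Lemma measurable_open_box (R : realType) (n : nat) (a b : 'rV[R]_n) :
  measurable (open_box a b).
Proof.
rewrite (_ : open_box a b =
    \bigcap_(j in [set: 'I_n]) ((fun x => x 0 j) @^-1` `]a 0 j, b 0 j[)).
  apply: fin_bigcap_measurable => // j _.
  rewrite -[X in measurable X]setTI; exact: measurable_coord_rV.
apply/seteqP; split=> [x abx j _ /=|x abx j].
  by rewrite in_itv/=; exact: abx.
by have := abx j I; rewrite /= in_itv.
Qed.

Lemma open_box_sub_ball (R : realType) (n : nat) (x a b : 'rV[R]_n) (e : R) :
  0 < e -> (forall j, x 0 j - e < a 0 j) -> (forall j, b 0 j < x 0 j + e) ->
  open_box a b `<=` [set y : 'rV[R]_n | forall j, `|x 0 j - y 0 j| < e].
Proof.
move=> e0 xa xb y aby j; rewrite ltr_norml.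
by have /andP[] := aby j; have := xa j; have := xb j; lra.
Qed.

Lemma nbhs_rV_coord (R : realType) (n : nat) (U : set 'rV[R]_n) (x : 'rV[R]_n) :
  nbhs x U ->
  exists2 e : R, 0 < e &
    [set y : 'rV[R]_n | forall j, `|x 0 j - y 0 j| < e] `<=` U.
Proof.
move=> /nbhs_ballP[e /= e0 xeU]; exists e => // y xey; apply: xeU.
by split=> // i j; rewrite ord1; exact: xey.
Qed.

(** The sigma-algebra is generated by the coordinates, so [U] has to be a countable union of boxes.
    [F] enumerates, through [unpickle], the boxes with rational corners, and replaces by the empty
    set those not contained in [U]. *)
Lemma open_measurable_rV (R : realType) (n : nat) (U : set 'rV[R]_n) :
  open U -> measurable U.
Proof.
move=> oU.
pose rbox (p : 'rV[rat]_n * 'rV[rat]_n) : set 'rV[R]_n :=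
  open_box (map_mx ratr p.1) (map_mx ratr p.2).
pose F k := if unpickle k is Some p
  then (if `[< rbox p `<=` U >] then rbox p else set0) else set0.
rewrite (_ : U = \bigcup_k F k).
  apply: bigcup_measurable => k _; rewrite /F.
  case: unpickle => // p; case: ifP => // _; exact: measurable_open_box.
apply/seteqP; split=> [x Ux|x [k _]]; last first.
  rewrite /F; case: unpickle => // p; case: ifPn => // /asboolP; exact.
have /nbhs_rV_coord[e e0 xeU] : nbhs x U by exact: open_nbhs_nbhs.
have /choice[a xa] : forall j, exists q : rat, x 0 j - e < ratr q < x 0 j.
  move=> j; have /rat_in_itvoo[q] : x 0 j - e < x 0 j by rewrite ltrBlDr ltrDl.
  by rewrite in_itv; exists q.
have /choice[b xb] : forall j, exists q : rat, x 0 j < ratr q < x 0 j + e.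
  move=> j; have /rat_in_itvoo[q] : x 0 j < x 0 j + e by rewrite ltrDl.
  by rewrite in_itv; exists q.
pose p := (\row_j a j, \row_j b j).
exists (pickle p) => //; rewrite /F pickleK ifT.
  by move=> j; rewrite !mxE; have /andP[_ ->] := xa j; have /andP[->] := xb j.
apply/asboolP; apply: subset_trans xeU; apply: open_box_sub_ball => // j.
  by rewrite !mxE; have /andP[] := xa j.
by rewrite !mxE; have /andP[] := xb j.
Qed.

(** Induction on the dimension: pulled back along [cons_rV], a box is an interval times a
    lower-dimensional box. Both bounds serve later: positivity for open sets, finiteness for the
    measure of the sphere. *)
Lemma lebesgue_open_box (R : realType) (n : nat) (a b : 'rV[R]_n) :
  (forall j, a 0 j < b 0 j) ->
  (0 < lebesgue_rV R n (open_box a b) < +oo)%E.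
Proof.
elim: n a b => [|n IH] a b ab.
  (* In dimension 0 the condition on coordinates is vacuous, so the box contains the only point and
     has mass 1. *)
  rewrite /= diracE mem_set ?lte01 ?ltry//.
  by case.
have -> : lebesgue_rV R n.+1 (open_box a b) =
    (lebesgue_measure \x lebesgue_rV R n)%E (`]a 0 0, b 0 0[ `*`
      open_box (uncons_rV a).2 (uncons_rV b).2).
  rewrite /= /lebesgue_rVS /pushforward; congr (_ _).
  apply/seteqP; split=> -[s x] /= H.
    split.
      have := H 0; rewrite in_itv/= /cons_rV (_ : 0 = @lshift 1 n 0).
        by rewrite (@row_mxEl _ _ 1 n) mxE eqxx.
      exact/val_inj.
    move=> j; have := H (rshift 1 j).
    by rewrite /cons_rV (@row_mxEr _ _ 1 n) !mxE.
  case: H => H0 H j; have [k ->|k ->] := @split_ordP 1 n j.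
    rewrite /cons_rV (@row_mxEl _ _ 1 n) ord1 mxE eqxx mulr1n.
    by rewrite (_ : lshift n 0 = 0) //; exact/val_inj.
  by rewrite /cons_rV (@row_mxEr _ _ 1 n); have := H k; rewrite !mxE.
rewrite product_measure1E//; last exact: measurable_open_box.
have /andP[l0 loo] :
    (0 < lebesgue_rV R n (open_box (uncons_rV a).2 (uncons_rV b).2) < +oo)%E.
  by apply: IH => j; rewrite !mxE.
have abE : lebesgue_measure (`]a 0 0, b 0 0[ : set R) = (b 0 0 - a 0 0)%:E.
  by rewrite lebesgue_measure_itv/= lte_fin ab EFinB.
rewrite [X in (0 < X * _)%E]abE [X in (X * _ < _)%E]abE; apply/andP; split.
  by rewrite mule_gt0// lte_fin subr_gt0.
by rewrite lte_mul_pinfty// lee_fin subr_ge0 ltW.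
Qed.

Lemma lebesgue_nbhs_gt0 (R : realType) (n : nat) (A : set 'rV[R]_n)
    (x : 'rV[R]_n) :
  measurable A -> nbhs x A -> (0 < lebesgue_rV R n A)%E.
Proof.
move=> mA /nbhs_rV_coord[e e0 xeA].
pose d := const_mx (e / 2) : 'rV[R]_n.
have /andP[+ _] : (0 < lebesgue_rV R n (open_box (x - d) (x + d)) < +oo)%E.
  by apply: lebesgue_open_box => j; rewrite !mxE; lra.
move=> /lt_le_trans; apply; apply: le_measure; rewrite ?inE//.
  exact: measurable_open_box.
by apply: subset_trans xeA; apply: open_box_sub_ball => // j; rewrite !mxE; lra.
Qed.

(** * The Euclidean norm, the sphere and its measure *)

Lemma ler_coord_enorm (R : rcfType) (n : nat) (x : 'rV[R]_n) (j : 'I_n) :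
  `|x 0 j| <= enorm x.
Proof.
rewrite -sqrtr_sqr ler_wsqrtr// (bigD1 j)//= lerDl sumr_ge0// => k _.
exact: sqr_ge0.
Qed.

Lemma enormZ (R : rcfType) (n : nat) (a : R) (x : 'rV[R]_n) :
  enorm (a *: x) = `|a| * enorm x.
Proof.
rewrite /enorm -sqrtr_sqr -sqrtrM ?sqr_ge0//; congr Num.sqrt.
by rewrite mulr_sumr; apply: eq_bigr => j _; rewrite mxE exprMn.
Qed.

Lemma continuous_enorm (R : realType) (n : nat) : continuous (@enorm R n).
Proof.
(* Summing over an arbitrary list of indices allows an induction on the list. *)
pose sumsq (s : seq 'I_n) (x : 'rV[R]_n) := \sum_(j <- s) x 0 j ^+ 2.
have csumsq s : continuous (sumsq s).
  elim: s => [|j s IH].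
    rewrite (_ : sumsq [::] = cst 0); first exact: cst_continuous.
    by apply/funext => x; rewrite /sumsq big_nil.
  rewrite (_ : sumsq (j :: s) = fun x => x 0 j ^+ 2 + sumsq s x).
    move=> x; apply: cvgD (IH x).
    apply: (@continuous_comp _ _ _ (fun x : 'rV[R]_n => x 0 j)
      (fun t => t ^+ 2)); [exact: coord_continuous|exact: exprn_continuous].
  by apply/funext => x; rewrite /sumsq big_cons.
move=> x; apply: (continuous_comp (csumsq (index_enum 'I_n) x)).
exact: sqrt_continuous.
Qed.

Lemma measurable_sphere (R : realType) (n : nat) : measurable (@sphere R n).
Proof.
rewrite (_ : sphere = @enorm R n @^-1` [set 1])//.
by rewrite -[X in measurable X]setTI; exact: measurable_enorm.
Qed.

(** Boundedness is meant in the sup norm, which the Euclidean norm dominates. *)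
Lemma compact_sphere (R : realType) (n : nat) : compact (@sphere R n).
Proof.
apply: bounded_closed_compact.
  exists 1; split => // M M1 x x1 /=.
  rewrite [leLHS]/Num.Def.normr/= mx_normrE (bigmax_le _ _)//=.
    by rewrite ltW// (lt_trans _ M1).
  move=> -[i j] _ /=; rewrite ord1 (le_trans (ler_coord_enorm _ _))//.
  by rewrite x1 ltW.
apply: preimage_closed (@closed_eq _ 1) => x _; exact: continuous_enorm.
Qed.

Lemma sphere_nonempty (R : realType) (n : nat) : (0 < n)%N ->
  @sphere R n !=set0.
Proof.
case: n => // n _; exists (delta_mx 0 0).
rewrite /sphere/= /enorm (bigD1 0)//= big1 ?addr0 ?mxE ?eqxx ?expr1n ?sqrtr1//.
by move=> j /negbTE j0; rewrite mxE j0 expr0n.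
Qed.

(** The cone over the sphere lies in the unit ball, hence in the box ]-2, 2[^n, which has finite
    volume. *)
Lemma spherical_measure_fin (R : realType) (n : nat) :
  (@spherical_measure R n sphere < +oo)%E.
Proof.
rewrite /spherical_measure /mscale /= lte_mul_pinfty//.
pose d := const_mx 2 : 'rV[R]_n.
have /andP[_] : (0 < lebesgue_rV R n (open_box (- d) d) < +oo)%E.
  by apply: lebesgue_open_box => j; rewrite !mxE; lra.
apply: le_lt_trans; rewrite /cone_volume /pushforward /mrestr.
apply: le_measure; rewrite ?inE//.
- apply: measurableI; last exact: measurable_unit_ball.
  rewrite -[X in measurable X]setTI; apply: measurable_direction => //.
  exact: measurable_sphere.
- exact: measurable_open_box.
- move=> x [_ x1] j; rewrite !mxE -ltr_norml.
  by rewrite (le_lt_trans (ler_coord_enorm x j))// (le_lt_trans x1)// ltr1n.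
Qed.

Lemma spherical_measure_gt0 (R : realType) (n : nat) (U : set 'rV[R]_n)
    (u : 'rV[R]_n) :
  measurable (sphere `&` U) -> sphere u -> nbhs u U ->
  (0 < @spherical_measure R n (sphere `&` U))%E.
Proof.
move=> mU u1 uU.
(* The factor [n] in [spherical_measure] must be nonzero; a point of norm 1 excludes dimension 0. *)
have n0 : (0 < n)%N.
  case: (posnP n) => // nE; subst n; move: u1.
  by rewrite /sphere /= /enorm big_ord0 sqrtr0 => /eqP; rewrite eq_sym oner_eq0.
rewrite /spherical_measure /mscale /= mule_gt0 ?lte_fin ?ltr0n//.
rewrite /cone_volume /pushforward /mrestr.
have mD : measurable (@direction R n @^-1` (sphere `&` U)).
  by rewrite -[X in measurable X]setTI; exact: measurable_direction.
(* Halfway along [u] the point is strictly inside the unit ball and away from 0, where [direction]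
   is continuous with value [u]. The cone is therefore a neighbourhood of it. *)
apply: (@lebesgue_nbhs_gt0 _ _ _ (2^-1 *: u)).
  by apply: measurableI => //; exact: measurable_unit_ball.
have eu : enorm (2^-1 *: u) = 2^-1 by rewrite enormZ u1 mulr1 ger0_norm.
have ncont : enorm y @[y --> (2^-1 *: u : 'rV[R]_n)] --> (2^-1 : R).
  by rewrite -[X in _ --> X]eu; exact: continuous_enorm.
have dcont : direction y @[y --> (2^-1 *: u : 'rV[R]_n)] --> u.
  rewrite [X in _ --> X](_ : u = (2^-1)^-1 *: (2^-1 *: u)).
    have h0 : (2^-1 : R) != 0 by rewrite invr_neq0.
    exact: (cvgZ (cvgV h0 ncont) (@cvg_id _ (nbhs (2^-1 *: u : 'rV[R]_n)))).
  by rewrite scalerA mulVf ?scale1r// invr_neq0.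
have dU := dcont _ uU.
near=> y.
have y0 : 0 < enorm y by near: y; apply: (cvgr_gt _ ncont).
have y1 : enorm y < 1.
  by near: y; apply: (cvgr_lt _ ncont); rewrite invf_lt1// ltr1n.
split; last exact: ltW.
split; last by near: y.
by rewrite /sphere /= enormZ ger0_norm ?invr_ge0 ?ltW// mulVf// gt_eqF.
Unshelve. all: by end_near.
Qed.

(** * Measurability, integrability and positive integrals on the sphere *)

Lemma within_continuous_measurable_rV (R : realType) (n : nat)
    (D : set 'rV[R]_n) (f : 'rV[R]_n -> R) :
  measurable D -> {within D, continuous f} -> measurable_fun D f.
Proof.
move=> mD /continuousP cf; apply: (measurability _ (RGenOpens.measurableE R)).
move=> _ [_ [a [b ->] <-]].
have /open_subspaceP[V oV VD] : open (f @^-1` `]a, b[ : set (subspace D)).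
  exact/cf/interval_open.
rewrite setIC -VD; apply: measurableI => //; exact: open_measurable_rV.
Qed.

(** If the integral vanished, the nonnegative [g] would be 0 almost everywhere on [D], and [A] would
    be negligible. *)
Lemma Rintegral_gt0 d (T : measurableType d) (R : realType)
    (mu : {measure set T -> \bar R}) (D A : set T) (g : T -> R) :
  measurable D -> measurable A -> A `<=` D -> mu.-integrable D (EFin \o g) ->
  (forall x, D x -> 0 <= g x) -> (forall x, A x -> 0 < g x) ->
  (0 < mu A)%E -> 0 < \int[mu]_(x in D) g x.
Proof.
move=> mD mA AD ig g0 gA muA; rewrite lt_neqAle Rintegral_ge0// andbT.
apply/negP => /eqP I0.
have /integrableP[mg _] := ig.
have : (\int[mu]_(x in D) `|(EFin \o g) x| = 0)%E.
  rewrite (eq_integral (EFin \o g)); last first.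
    by move=> x /set_mem Dx; rewrite /= ger0_norm// g0.
  rewrite -[LHS]fineK; last exact: integrable_fin_num.
  by rewrite [fine _](_ : _ = \int[mu]_(x in D) g x)// -I0.
move=> /(ae_eq_integral_abs _ mD mg) ae0.
have : mu.-negligible A.
  apply: negligibleS ae0 => x Ax /= gx0.
  have := gA x Ax; have := gx0 (AD x Ax) => -[->].
  by rewrite ltxx.
move=> /(measure_negligible mA) muA0.
by rewrite muA0 ltxx in muA.
Qed.

Lemma sphere_integrable (R : realType) (n : nat) (f : 'rV[R]_n -> R) (M : R) :
  measurable_fun sphere f -> (forall u, sphere u -> `|f u| <= M) ->
  (@spherical_measure R n).-integrable sphere (EFin \o f).
Proof.
move=> mf fM; apply: measurable_bounded_integrable => //.
- exact: measurable_sphere.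
- exact: spherical_measure_fin.
exists M; split; first exact: num_real.
by move=> y My u u1 /=; rewrite (le_trans (fM u u1))// ltW.
Qed.

Lemma within_continuous_integrable_sphere (R : realType) (n : nat)
    (f : 'rV[R]_n -> R) : (0 < n)%N -> {within sphere, continuous f} ->
  (@spherical_measure R n).-integrable sphere (EFin \o f).
Proof.
move=> n0 cf.
have mf := within_continuous_measurable_rV (@measurable_sphere R n) cf.
have [v _ fv] := EVT_max_rV (sphere_nonempty R n0) (@compact_sphere R n) cf.
have [w _ fw] := EVT_min_rV (sphere_nonempty R n0) (@compact_sphere R n) cf.
apply: (@sphere_integrable _ _ _ (`|f v| + `|f w|)) => // u /mem_set u1.
have := fv u u1; have := fw u u1.
have := ler_norm (f v); have := ler_norm (- f w).
rewrite normrN; have := normr_ge0 (f v); have := normr_ge0 (f w).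
by rewrite ler_norml; lra.
Qed.

(** The continuous [f] supplies the open set and [g] the integrand: [f != a] is relatively open and
    contains [u], so it has positive measure, and [g] is positive on it. It is used with [f] equal
    to [g] and [a] equal to 0, and with [f] the ratio of radial functions and [g] the function
    [gap]. *)
Lemma Rintegral_sphere_gt0 (R : realType) (n : nat) (f g : 'rV[R]_n -> R)
    (u : 'rV[R]_n) (a : R):
  (@spherical_measure R n).-integrable sphere (EFin \o g) ->
  {within sphere, continuous f} -> sphere u -> f u != a ->
  (forall v, sphere v -> 0 <= g v) ->
  (forall v, sphere v -> f v != a -> 0 < g v) ->
  0 < \int[@spherical_measure R n]_(v in sphere) g v.
Proof.
move=> ig /continuousP cf u1 fua g0 gfa.
have /open_subspaceP[V oV VE] := cf _ (@open_neq R a).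
have VP v : sphere v -> V v <-> f v != a.
  move=> v1.
  have : (V `&` sphere) v <-> (f @^-1` [set x | x != a] `&` sphere) v.
    by rewrite VE.
  move=> [VS SV]; split=> [Vv|fv]; first by have [] := VS (conj Vv v1).
  by have [] := SV (conj fv v1).
have mV : measurable (sphere `&` V).
  by apply: measurableI; [exact: measurable_sphere|exact: open_measurable_rV].
apply: (@Rintegral_gt0 _ _ _ _ _ (sphere `&` V)) => //.
- exact: measurable_sphere.
- by move=> v [v1 /(VP v v1)]; exact: gfa.
apply: (@spherical_measure_gt0 _ _ _ u) => //.
by apply: open_nbhs_nbhs; split=> //; apply/VP.
Qed.

(** * The inequality and its equality case for two star bodies *)

Section two_star_bodies.
Context (R : realType) (n i : nat) (K L : set 'rV[R]_n) (phi : R -> R)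
  (starK : star_body K) (starL : star_body L) (ltin : (i < n)%N)
  (phiC : class_C phi).

Local Notation mu := (@spherical_measure R n).
Local Notation p := (n - i)%N.
Local Notation ratio u := (radial L u / radial K u).

Let n0 : (0 < n)%N. Proof. by case: n ltin. Qed.
Let p0 : (0 < p)%N. Proof. by rewrite subn_gt0. Qed.

Let radial_gt0 (B : set 'rV[R]_n) u : star_body B -> sphere u -> 0 < radial B u.
Proof. by case=> _ _ B0 _; exact: B0. Qed.

Let ratio_gt0 u : sphere u -> 0 < ratio u.
Proof. by move=> u1; rewrite divr_gt0 ?radial_gt0. Qed.

Lemma within_continuous_radialX (B : set 'rV[R]_n) : star_body B ->
  {within sphere, continuous (fun u => radial B u ^+ p)}.
Proof.
case=> _ _ _ cB u; apply: (@continuous_comp (subspace (@sphere R n)) R R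
  (radial B) (fun t => t ^+ p)); [exact: cB|exact: exprn_continuous].
Qed.

Lemma within_continuous_ratio : {within sphere, continuous (fun u => ratio u)}.
Proof.
have [_ _ K0 cK] := starK; have [_ _ _ cL] := starL.
rewrite continuous_subspace_in => u /set_mem u1.
apply: cvgM; first exact: cL.
apply: cvgV; last exact: cK.
by rewrite gt_eqF// K0.
Qed.

Lemma integrable_radialX (B : set 'rV[R]_n) : star_body B ->
  mu.-integrable sphere (EFin \o (fun u => radial B u ^+ p)).
Proof.
move=> starB; apply: within_continuous_integrable_sphere => //.
exact: within_continuous_radialX.
Qed.

Lemma Rintegral_radialX_gt0 (B : set 'rV[R]_n) : star_body B ->
  0 < \int[mu]_(u in sphere) (radial B u ^+ p).
Proof.
move=> starB; have [u u1] := sphere_nonempty R n0.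
apply: (@Rintegral_sphere_gt0 _ _ _ _ u 0 (integrable_radialX starB)
  (within_continuous_radialX starB) u1).
- by rewrite gt_eqF// exprn_gt0// radial_gt0.
- by move=> v v1; rewrite exprn_ge0// ltW// radial_gt0.
- by move=> v v1 _; rewrite exprn_gt0// radial_gt0.
Qed.

(** The integrand is bounded by [phi] at the minimum of the ratio times the maximum of the power of
    [radial K]; both extrema are attained by compactness. *)
Lemma integrable_orlicz :
  mu.-integrable sphere (EFin \o (fun u => phi (ratio u) * radial K u ^+ p)).
Proof.
have [phi0 _ dphi _ _] := phiC.
have [v /set_mem v1 vmin] := EVT_min_rV (sphere_nonempty R n0)
  (@compact_sphere R n) within_continuous_ratio.
have [w /set_mem w1 wmax] := EVT_max_rV (sphere_nonempty R n0)
  (@compact_sphere R n) (within_continuous_radialX starK).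
have mS := @measurable_sphere R n.
have a0 := ratio_gt0 v1.
(* [phi] is monotone only on the positive reals and arbitrary elsewhere. Truncating its argument
   below at the least ratio gives a function monotone on all of R, hence measurable, with the same
   values along the ratio. *)
pose psi t := phi (Num.max t (ratio v)).
have psiE u : sphere u -> phi (ratio u) = psi (ratio u).
  by move=> u1; rewrite /psi max_l// vmin// inE.
have mphi : measurable_fun sphere (fun u => phi (ratio u)).
  apply: (@eq_measurable_fun _ _ _ _ _ (psi \o (fun u => ratio u))).
    by move=> u /set_mem u1; rewrite /= psiE.
  apply: (@measurableT_comp _ _ _ _ _ _ psi).
    apply: nonincreasing_measurable => // s t st; apply: dphi.
      by rewrite lt_max a0 orbT.
    by rewrite ge_max !le_max st lexx orbT.
  exact: within_continuous_measurable_rV within_continuous_ratio.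
apply: (@sphere_integrable _ _ _ (phi (ratio v) * radial K w ^+ p)).
  apply: measurable_funM => //.
  exact: within_continuous_measurable_rV (within_continuous_radialX starK).
move=> u u1; have k0 := radial_gt0 starK u1.
rewrite ger0_norm; last first.
  by rewrite mulr_ge0// ltW// ?exprn_gt0// phi0// ratio_gt0.
apply: ler_pM.
- by rewrite ltW// phi0// ratio_gt0.
- by rewrite exprn_ge0// ltW.
- by apply: dphi => //; rewrite vmin// inE.
- by apply: wmax; rewrite inE.
Qed.

(** The factor 1/n is left out of these integrals: it cancels in the quotient defining [m] and
    appears on both sides of the inequality. *)
Let WK := \int[mu]_(u in sphere) (radial K u ^+ p).
Let WL := \int[mu]_(u in sphere) (radial L u ^+ p).
Let I := \int[mu]_(u in sphere) (phi (ratio u) * radial K u ^+ p).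
Let m := (WL / WK) `^ (1 / p%:R).

Let WK0 : 0 < WK. Proof. exact: Rintegral_radialX_gt0. Qed.
Let WL0 : 0 < WL. Proof. exact: Rintegral_radialX_gt0. Qed.
Let m0 : 0 < m. Proof. by rewrite powR_gt0// divr_gt0. Qed.

Let mX : m ^+ p = WL / WK.
Proof.
rewrite -powR_mulrn ?powR_ge0// -powRrM div1r mulVf ?pnatr_eq0 -?lt0n//.
by rewrite powRr1// divr_ge0// ltW.
Qed.

(* By the choice of [m] the terms in [c] integrate to [0]. *)
Let gap c u := phi (ratio u) * radial K u ^+ p -
  ((phi m - c * m ^+ p) * radial K u ^+ p + c * radial L u ^+ p).

(** The definition of [gap] splits into integrable terms. This factored form shows its sign through
    [power_support]. *)
Let gapE c u : sphere u ->
  gap c u = (phi (ratio u) - (phi m + c * (ratio u ^+ p - m ^+ p))) *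
            radial K u ^+ p.
Proof.
move=> u1; rewrite /gap expr_div_n; field.
by rewrite expf_neq0// gt_eqF// radial_gt0.
Qed.

Let integrable_radialXZ c (B : set 'rV[R]_n) : star_body B ->
  mu.-integrable sphere (EFin \o (fun u => c * radial B u ^+ p)).
Proof.
move=> starB; apply: within_continuous_integrable_sphere => // u.
apply: cvgM; first exact: cvg_cst.
exact: within_continuous_radialX.
Qed.

Let integrable_tangent c : mu.-integrable sphere (EFin \o
  (fun u => (phi m - c * m ^+ p) * radial K u ^+ p + c * radial L u ^+ p)).
Proof.
apply: (eq_integrable _ _ _ _ (integrableD (@measurable_sphere R n)
  (integrable_radialXZ (phi m - c * m ^+ p) starK)
  (integrable_radialXZ c starL))) => //.
exact: measurable_sphere.
Qed.

Let integrable_gap c : mu.-integrable sphere (EFin \o gap c).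
Proof.
apply: (eq_integrable _ _ _ _ (integrableB (@measurable_sphere R n)
  integrable_orlicz (integrable_tangent c))) => //.
exact: measurable_sphere.
Qed.

Let Rintegral_gap c : \int[mu]_(u in sphere) gap c u = I - WK * phi m.
Proof.
have mS := @measurable_sphere R n.
have iK := integrable_radialX starK; have iL := integrable_radialX starL.
rewrite /gap RintegralB//; last exact: integrable_orlicz.
have iZK := integrable_radialXZ (phi m - c * m ^+ p) starK.
have iZL := integrable_radialXZ c starL.
rewrite RintegralD// !RintegralZl//.
by rewrite -/WK -/WL -/I mX; field; rewrite gt_eqF.
Qed.

Lemma orlicz_ge : WK * phi m <= I.
Proof.
have [_ cphi dphi _ _] := phiC.
have [c [cle _]] := power_support cphi dphi m0 p0.
rewrite -subr_ge0 -(Rintegral_gap c); apply: Rintegral_ge0 => u u1.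
rewrite gapE// mulr_ge0//.
  by rewrite subr_ge0 cle// ratio_gt0.
by rewrite exprn_ge0// ltW// radial_gt0.
Qed.

Lemma orlicz_eq_ratio : strictly_convex phi -> I = WK * phi m ->
  forall u, sphere u -> ratio u = m.
Proof.
move=> sphi IE u u1; apply/eqP/negPn/negP => um.
have [_ cphi dphi _ _] := phiC.
have [c [cle clt]] := power_support cphi dphi m0 p0.
have : 0 < \int[mu]_(u in sphere) gap c u.
  apply: (Rintegral_sphere_gt0 (integrable_gap c) within_continuous_ratio
    u1 um) => v v1 => [|vm]; have k0 := radial_gt0 starK v1; rewrite gapE//.
    by rewrite mulr_ge0 ?exprn_ge0 ?(ltW k0)// subr_ge0 cle// ratio_gt0.
  by rewrite mulr_gt0 ?exprn_gt0// subr_gt0 clt// ratio_gt0.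
by rewrite Rintegral_gap IE subrr ltxx.
Qed.

(** A constant ratio must equal [m], since [WL] is then its [p]-th power times [WK]; so the constant
    [phi m] factors out of [I]. *)
Lemma orlicz_eq_dilates : dilates K L -> I = WK * phi m.
Proof.
move=> [c KL]; have [u0 u01] := sphere_nonempty R n0.
(* A point of the sphere is needed to see that [c] is positive, so that taking the [p]-th root of
   [c^-1 ^+ p] gives back [c^-1]. *)
have c0 : 0 < c by rewrite -(KL u0)// divr_gt0// radial_gt0.
have ratioE u : sphere u -> ratio u = c^-1.
  by move=> u1; rewrite -(KL u u1) invf_div.
have WLE : WL = c^-1 ^+ p * WK.
  rewrite /WL -RintegralZl//; last 2 first.
  - exact: measurable_sphere.
  - exact: integrable_radialX.
  apply: eq_Rintegral => u /set_mem u1; rewrite -exprMn -(ratioE u)//.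
  by rewrite divfK// gt_eqF// radial_gt0.
have mE : m = c^-1.
  rewrite /m WLE mulfK ?gt_eqF// -powR_mulrn ?invr_ge0 ?ltW// -powRrM.
  by rewrite div1r mulfV ?pnatr_eq0 -?lt0n// powRr1// invr_ge0 ltW.
rewrite mE mulrC -RintegralZl//; last 2 first.
- exact: measurable_sphere.
- exact: integrable_radialX.
by apply: eq_Rintegral => u /set_mem u1; rewrite ratioE.
Qed.

Lemma dual_quermassE : dual_quermass i L / dual_quermass i K = WL / WK.
Proof.
rewrite /dual_quermass -/WK -/WL -mulf_div divff ?mul1r//.
by rewrite invr_eq0 pnatr_eq0 -lt0n.
Qed.

End two_star_bodies.

Theorem corollary5p4 (R : realType) (n i : nat) (K L : set 'rV[R]_n)
    (phi : R -> R) :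
  star_body K -> star_body L -> (i < n)%N -> class_C phi ->
  (dual_quermass i K *
     phi ((dual_quermass i L / dual_quermass i K) `^ (1 / (n - i)%:R))
   <= orlicz_dual_mixed_quermass phi i K L) /\
  (strictly_convex phi ->
   (orlicz_dual_mixed_quermass phi i K L =
    dual_quermass i K *
      phi ((dual_quermass i L / dual_quermass i K) `^ (1 / (n - i)%:R))
    <-> dilates K L)).
Proof.
move=> starK starL ltin phiC.
have nV0 : 0 < n%:R^-1 :> R by rewrite invr_gt0 ltr0n (leq_ltn_trans _ ltin).
rewrite dual_quermassE// /orlicz_dual_mixed_quermass /dual_quermass -mulrA.
set m := _ `^ _; split; first by rewrite ler_pM2l//; exact: orlicz_ge.
move=> sphi; split=> [/(mulfI (lt0r_neq0 nV0)) IE|KL]; last first.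
  by congr (_ * _); exact: orlicz_eq_dilates.
(* [dilates] divides [radial K] by [radial L], the inverse of the ratio that equals [m]. *)
exists m^-1 => u u1.
by rewrite -[LHS]invf_div (orlicz_eq_ratio starK starL ltin phiC sphi IE u1).
Qed.
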